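(* Let $\Delta=[-\frac{\pi}{2},\frac{\pi}{2}]$ and define $K_i:\Delta\times\Delta\to\mathbb{R}$ by $K_i(x,y)=2-\frac{\pi}{2}\sin|x-y|$. For $y\in\Delta$ put $k_y=K_i(\cdot,y)$. Then for every $f\in H^1_0(\Delta)$ and every $y\in\Delta$ one has $k_y\in H^1_0(\Delta)$ and $$f(y)=\langle f,k_y\rangle_i,$$ i.e. $K_i$ is a reproducing kernel for the inner product space $(H^1_0(\Delta),\langle\cdot,\cdot\rangle_i)$.
   Context: $H^1(\Delta)$ denotes the space of absolutely continuous functions $f:\Delta\to\mathbb{R}$ whose (a.e. defined) derivative $f'$ lies in $L_2(\Delta)$. $H^1_0(\Delta)$ is the subspace of those $f\in H^1(\Delta)$ with $f(-\frac{\pi}{2})=f(\frac{\pi}{2})$. For $f,g\in H^1_0(\Delta)$, $$\langle f,g\rangle_i=\frac{1}{\pi^2}\Big[2\Big(\int_{-\pi/2}^{\pi/2}f\Big)\Big(\int_{-\pi/2}^{\pi/2}g\Big)-\pi\int_{-\pi/2}^{\pi/2}\big(fg-f'g'\big)\Big],$$ which is a positive definite inner product on $H^1_0(\Delta)$. *)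

(* Defs.v *)
From HB Require Import structures.
From mathcomp Require Import all_boot all_order all_algebra.
From mathcomp Require Import all_classical all_reals all_analysis.
Set Implicit Arguments. Unset Strict Implicit. Unset Printing Implicit Defensive.
Import Order.TTheory GRing.Theory Num.Theory.
Import numFieldNormedType.Exports.
Local Open Scope classical_set_scope.
Local Open Scope ring_scope.

Definition Delta (R : realType) : set R := `[- (pi / 2), pi / 2]%classic.
Arguments Delta R : clear implicits.

Definition abs_cont_on (R : realType) (a b : R) (f : R -> R) : Prop :=
  forall e : R, 0 < e -> exists2 d : R, 0 < d &
    forall (n : nat) (u v : nat -> R),
      (forall i, (i < n)%N -> a <= u i /\ u i <= v i /\ v i <= b) ->
      (forall i j, (i < n)%N -> (j < n)%N -> i <> j -> v i <= u j \/ v j <= u i) ->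
      \sum_(i < n) (v i - u i) < d ->
      \sum_(i < n) `|f (v i) - f (u i)| < e.

Definition sq_integrable (R : realType) (D : set R) (g : R -> R) : Prop :=
  measurable_fun D g /\
  (lebesgue_measure : set _ -> \bar R).-integrable D (fun x => (g x ^+ 2)%:E).

Definition ae_deriv (R : realType) (D : set R) (f g : R -> R) : Prop :=
  {ae (lebesgue_measure : set _ -> \bar R), forall x, D x -> is_derive x 1 f (g x)}.

Definition H1_with_deriv (R : realType) (f f' : R -> R) : Prop :=
  abs_cont_on (- ((pi : R) / 2)) (pi / 2) f /\ ae_deriv (Delta R) f f' /\
  sq_integrable (Delta R) f'.

Definition H1 (R : realType) (f : R -> R) : Prop :=
  abs_cont_on (- ((pi : R) / 2)) (pi / 2) f /\
  exists2 f' : R -> R, ae_deriv (Delta R) f f' & sq_integrable (Delta R) f'.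

Definition H1_0 (R : realType) (f : R -> R) : Prop :=
  H1 f /\ f (- (pi / 2)) = f (pi / 2).

Definition intD (R : realType) (f : R -> R) : R :=
  Rintegral (lebesgue_measure : set _ -> \bar R) (Delta R) f.

Definition inner_i (R : realType) (f f' g g' : R -> R) : R :=
  (pi ^+ 2)^-1 * (2 * intD f * intD g
     - pi * intD (fun x => f x * g x - f' x * g' x)).

Definition K_i (R : realType) (x y : R) : R := 2 - (pi / 2) * sin `|x - y|.

(* Main.v *)
(** On either side of [y] the kernel [k] satisfies [k'' = 2 - k], so
    [2 f - (f k - f' k')] is there the derivative of [f k'].  The jump of [k']
    at [y] is [- pi], and the boundary terms at [- pi / 2] and [pi / 2] cancel
    by periodicity, whence [int (f k - f' k') = 2 int f - pi f(y)].  Applying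
    this to [f] and to the constant [1] (which yields [int k = pi]) gives the
    reproducing property.

    The integration needs [int F' = F(b) - F(a)] for absolutely continuous [F].
    By Lebesgue differentiation, [G = F - int F'] has zero derivative off a null
    set; cover the null set by an open set of small measure.  A point of the
    interval has then a neighbourhood where either [G] has slope at most [eps]
    or which lies in the open set, where absolute continuity applies.  Gluing
    these local estimates bounds [|G(b) - G(a)|] by [O(eps)]. *)
Require Import Defs.
From HB Require Import structures.
From mathcomp Require Import all_boot all_order all_algebra.
From mathcomp Require Import all_classical all_reals all_analysis.
From mathcomp Require Import measurable_realfun.
From mathcomp Require Import ring lra.
Import Order.TTheory GRing.Theory Num.Theory.
Import numFieldNormedType.Exports.
Local Open Scope classical_set_scope.
Local Open Scope ring_scope.

Local Notation mu := (@lebesgue_measure _).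

Lemma interval_local_to_global (R : realType) (a b : R) (Q : R -> R -> Prop) :
  a <= b ->
  (forall s t r, a <= s -> s <= t -> t <= r -> r <= b ->
     Q s t -> Q t r -> Q s r) ->
  (forall x, a <= x -> x <= b -> exists2 d : R, 0 < d &
     forall s t, a <= s -> x - d < s -> s <= x -> x <= t -> t < x + d ->
       t <= b -> Q s t) ->
  Q a b.
Proof.
move=> ab Qadd Qloc; pose S := [set t | [/\ a <= t, t <= b & Q a t]].
have Sa : S a.
  split => //; have [d d0 Qd] := Qloc a (lexx a) ab.
  by apply: Qd => //; rewrite ?gtrBl ?ltrDl.
have hS : has_sup S by split; [exists a | exists b => t []].
have [ac cb] : a <= sup S /\ sup S <= b.
  split; first by apply: ub_le_sup => //; exact: hS.2.
  by apply: ge_sup => [|t []//]; exists a.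
have [d d0 Qd] := Qloc _ ac cb.
have [t [at_ tb Qat] ltt] := sup_adherent d0 hS.
have tc : t <= sup S by apply: ub_le_sup; [exact: hS.2|].
have step c' : sup S <= c' -> c' < sup S + d -> c' <= b -> Q a c'.
  move=> cc' c'd c'b; apply: (Qadd a t c') => //; first exact: le_trans cc'.
  exact: Qd.
have [cltb|bc] := ltP (sup S) b; last first.
  by apply: step => //; rewrite (le_lt_trans bc)// ltrDl.
pose c' := Num.min b (sup S + d / 2).
have cc' : sup S < c' by rewrite /c' lt_min cltb ltrDl divr_gt0.
have c'b : c' <= b by rewrite /c' ge_min lexx.
have : S c'.
  split => //; first by rewrite (le_trans ac)// ltW.
  apply: step => //; first exact: ltW.
  by rewrite /c' gt_min ltrD2l gtr_pMr// invf_lt1 ?ltr1n ?orbT.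
by move=> /(ub_le_sup hS.2); rewrite leNgt cc'.
Qed.

Lemma is_derive0_locally_flat {R : realType} (G : R -> R) (x e : R) :
  is_derive x 1 G 0 -> 0 < e ->
  exists2 d : R, 0 < d & forall t, `|t - x| < d -> `|G t - G x| <= e * `|t - x|.
Proof.
move=> [dG dG0] e0.
have : h^-1 *: (G (h *: 1 + x) - G x) @[h --> 0^'] --> (0 : R).
  by rewrite -[X in _ --> X]dG0; exact: dG.
move=> /cvgrPdist_le/(_ _ e0)[d /= d0 dP].
exists d => // t td; have [->|tx] := eqVneq t x.
  by rewrite !subrr normr0 mulr0.
have := dP (t - x); rewrite /= sub0r normrN subr_eq0 => /(_ td tx).
rewrite [_%:A]mulr1 subrK sub0r normrN normrM normfV.
by rewrite ler_pdivrMl ?normr_gt0 ?subr_eq0// mulrC.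
Qed.

Lemma abs_cont_on_seq {R : realType} (a b : R) (F : R -> R) (e : R) :
  abs_cont_on a b F -> 0 < e -> exists2 d : R, 0 < d &
  forall l : seq (R * R),
    all (fun p => (a <= p.1) && (p.1 <= p.2) && (p.2 <= b)) l ->
    pairwise (fun p q => p.2 <= q.1) l ->
    \sum_(p <- l) (p.2 - p.1) < d ->
    \sum_(p <- l) `|F p.2 - F p.1| < e.
Proof.
move=> acF e0; have [d d0 dP] := acF _ e0; exists d => // l lab lpw.
rewrite !(big_nth (0, 0)) !big_mkord => ld.
apply: (dP (size l) (fun i => (nth (0, 0) l i).1)
                    (fun i => (nth (0, 0) l i).2)) => //.
  by move=> i il; move/(all_nthP (0, 0)) : lab => /(_ _ il)/andP[/andP[]].
move=> i j il jl; have lp := pairwiseP (0, 0) lpw.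
move=> /eqP; rewrite neq_ltn => /orP[ij|ij]; [left|right]; exact: lp.
Qed.

Lemma Rintegral_setI_itvU {R : realType} (A : set R) (phi : R -> R)
    (s t r : R) :
  measurable A -> mu.-integrable A (EFin \o phi) -> s <= t -> t <= r ->
  \int[mu]_(x in A `&` `]s, r]) phi x =
  \int[mu]_(x in A `&` `]s, t]) phi x + \int[mu]_(x in A `&` `]t, r]) phi x.
Proof.
move=> mA iphi st tr.
have -> : A `&` `]s, r] = (A `&` `]s, t]) `|` (A `&` `]t, r]).
  by rewrite -setIUr -itv_bndbnd_setU.
rewrite Rintegral_setU//.
- exact: measurableI.
- exact: measurableI.
- apply: integrableS iphi => //; first by apply: measurableU; exact: measurableI.
  by rewrite -setIUr; exact: subIsetl.
- apply/disj_setPS => x [[_ /=]]; rewrite in_itv/= => /andP[_ xt] [_ /=].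
  by rewrite in_itv/= ltNge xt.
Qed.

Lemma abs_cont_FTC2 {R : realType} (a b : R) (F h : R -> R) :
  a <= b -> abs_cont_on a b F ->
  {ae mu, forall x, a < x < b -> is_derive x 1 F (h x)} ->
  mu.-integrable `[a, b] (EFin \o h) ->
  \int[mu]_(x in `[a, b]) h x = F b - F a.
Proof.
move=> ab acF dF ih; pose g := h \_ `[a, b].
have ig : mu.-integrable setT (EFin \o g).
  by rewrite /g -restrict_EFin; apply/integrable_restrict => //; rewrite setTI.
have igS A : measurable A -> mu.-integrable A (EFin \o g).
  by move=> mA; apply: integrableS ig.
pose H x := \int[mu]_(t in `]-oo, x]) g t.
have HB s t : s <= t -> H t - H s = \int[mu]_(x in `]s, t]) g x.
  by move=> st; rewrite /H Rintegral_itvB//; exact: igS.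
pose G x := F x - H x.
suff GE : G b = G a.
  have -> : F b - F a = H b - H a by move: GE; rewrite /G; lra.
  rewrite HB// Rintegral_itv_obnd_cbnd; last exact: igS.
  by apply: eq_Rintegral => x xab; rewrite /g patchE xab.
apply/eqP; rewrite -subr_eq0 -normr_le0; apply/ler_addgt0Pr => e e0.
rewrite add0r.
pose eps := e / (b - a + 2).
have ba2 : 0 < b - a + 2 by move: ab; lra.
have eps0 : 0 < eps by rewrite divr_gt0.
have dG : {ae mu, forall x, a < x < b -> is_derive x 1 G 0}.
  have locg : locally_integrable setT g.
    by apply: open_integrable_locally => //; exact: openT.
  have dH := FTC1Ny (fun y => igS _ (measurable_itv _)) locg.
  move: dF dH; apply: filterS2; first exact: (ae_filter_ringOfSetsType mu).
  move=> x dFx [dHx Hx] xab.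
  have -> : 0 = h x - g x :> R.
    by rewrite /g patchE ifT ?subrr// inE/= in_itv/= !ltW//; case/andP: xab.
  apply: is_deriveB; first exact: dFx.
  by apply: DeriveDef => //; rewrite -derive1E.
have [N [mN N0 NP]] := dG.
have {}mN : measurable (N : set R) by exact: mN.
have {}N0 : mu N = 0%E by exact: N0.
have mb : measurable ([set a; b] : set R).
  by apply: measurableU; exact: measurable_set1.
pose N' : set R := N `|` [set a; b].
have mN' : measurable N' by exact: measurableU.
have N'0 : mu N' = 0%E.
  apply: null_set_setU => //; apply: null_set_setU => //;
    exact: lebesgue_measure_set1.
have [d1 d10 acFd] := abs_cont_on_seq _ _ _ _ acF eps0.
have [d2 [d20 acHd]] := integral_normr_continuous ig eps0.
pose d := Num.min d1 d2.
have d0 : 0 < d by rewrite lt_min d10.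
have [U [oU N'U muU]] : exists U, [/\ open U, N' `<=` U & (mu U < d%:E)%E].
  have N'fin : (mu N' < +oo)%E by rewrite N'0.
  have [U [oU N'U muU]] := lebesgue_regularity_outer mN' N'fin d0.
  exists U; split => //; rewrite -(setDUK N'U) setUC measureU0//.
  by apply: measurableD => //; exact: open_measurable.
have mU : measurable U by exact: open_measurable.
have mUI s t : measurable (U `&` `]s, t]) by exact: measurableI.
have i1 : mu.-integrable U (EFin \o cst 1).
  apply: measurable_bounded_integrable => //; last exact: bounded_cst.
  by rewrite (lt_trans muU) ?ltry.
have ing : mu.-integrable U (EFin \o (fun x => `|g x|)).
  exact: integrable_abse (igS _ mU).
pose m s t := \int[mu]_(x in U `&` `]s, t]) 1.
pose J s t := \int[mu]_(x in U `&` `]s, t]) `|g x|.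
(* Bounding the lengths in [l] by [m s t] rather than by [d] makes [Q] stable
   under gluing of adjacent intervals; [m a b < d] is used only at the end. *)
pose Q s t := exists l : seq (R * R), [/\
  all (fun p => (s <= p.1) && (p.1 <= p.2) && (p.2 <= t)) l,
  pairwise (fun p q => p.2 <= q.1) l,
  \sum_(p <- l) (p.2 - p.1) <= m s t &
  `|G t - G s| <= eps * (t - s) + \sum_(p <- l) `|F p.2 - F p.1| + J s t].
have : Q a b.
  apply: interval_local_to_global => // [s t r _ st tr _|x ax xb].
    move=> [l1 [l1st l1pw l1m l1G]] [l2 [l2tr l2pw l2m l2G]].
    exists (l1 ++ l2); split.
    - rewrite all_cat; apply/andP; split.
        apply: sub_all l1st => p /andP[-> /=] pt; exact: le_trans tr.
      apply: sub_all l2tr => p /andP[/andP[tp -> ->]]; rewrite !andbT.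
      exact: le_trans tp.
    - rewrite pairwise_cat l1pw l2pw !andbT; apply/allrelP => p q pl1 ql2.
      move/allP : l1st => /(_ _ pl1)/andP[_ pt].
      by move/allP : l2tr => /(_ _ ql2)/andP[/andP[tq _] _]; exact: le_trans tq.
    - by rewrite big_cat/= /m (Rintegral_setI_itvU _ _ _ _ _ mU i1 st tr) lerD.
    - rewrite big_cat/= /J (Rintegral_setI_itvU _ _ _ _ _ mU ing st tr).
      have := ler_normD (G r - G t) (G t - G s); rewrite subrKA.
      move: l1G l2G; rewrite /J; lra.
  have J0 s t : 0 <= J s t by exact: Rintegral_ge0.
  have m0 s t : 0 <= m s t by exact: Rintegral_ge0.
  have [xN|xN] := pselect (N' x).
    have /nbhs_ballP[r /= r0 rU] := open_nbhs_nbhs (conj oU (N'U _ xN)).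
    exists r => // s t _ rs sx xt tr _.
    have stU : `]s, t] `<=` U.
      move=> z; rewrite /= in_itv/= => /andP[sz zt]; apply: rU.
      by rewrite /ball/= ltr_norml; move: rs tr sx xt sz zt; lra.
    have st := le_trans sx xt.
    exists [:: (s, t)]; split => /=; rewrite ?lexx ?st//.
    - rewrite big_seq1/= /m setIidr// Rintegral_cst//= lebesgue_measure_itv/=.
      rewrite mul1r lte_fin; case: ltP => //= ts.
      by rewrite subr_le0.
    - rewrite big_seq1/= /J setIidr//.
      have ist : `|\int[mu]_(x in `]s, t]) g x| <=
          \int[mu]_(x in `]s, t]) `|g x|.
        by apply: le_normr_Rintegral => //; exact: igS.
      have -> : G t - G s = (F t - F s) - (H t - H s) by rewrite /G; ring.
      rewrite HB//; apply: (le_trans (ler_normB _ _)).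
      rewrite lerD// ler_wpDl// mulr_ge0 ?subr_ge0//.
      exact: ltW.
  have dGx : is_derive x 1 G 0.
    apply: contrapT => ndGx; apply: xN.
    have [->|xa] := eqVneq x a; first by right; left.
    have [->|xb'] := eqVneq x b; first by right; right.
    left; apply: NP => /= xP; apply/ndGx/xP.
    by rewrite !lt_neqAle ax xb xb' eq_sym xa.
  have [r r0 rG] := is_derive0_locally_flat _ _ _ dGx eps0.
  exists r => // s t _ rs sx xt tr _; exists [::]; split => //.
    by rewrite big_nil.
  rewrite big_nil addr0 (le_trans _ (ler_wpDr _ (lexx _)))//.
  have := ler_normD (G t - G x) (G x - G s); rewrite subrKA => /le_trans; apply.
  have tx : `|t - x| = t - x by rewrite ger0_norm// subr_ge0.
  have xs : `|s - x| = x - s by rewrite ler0_norm ?opprB// subr_le0.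
  have := rG t; have := rG s; rewrite (distrC (G s)) tx xs.
  rewrite !ltrBlDl -ltrBlDr => /(_ rs) + /(_ tr).
  lra.
move=> [l [lab lpw lm lG]].
have muUI : (mu (U `&` `]a, b]) < d%:E)%E.
  apply: le_lt_trans muU; apply: le_measure; rewrite ?inE.
  - exact: mUI.
  - exact: mU.
  - exact: subIsetl.
have mab : m a b < d.
  rewrite /m Rintegral_cst; last exact: mUI.
  rewrite mul1r -lte_fin fineK// fin_num_abs gee0_abs//.
  exact: lt_trans muUI (ltry d).
have Jab : J a b < eps.
  apply: acHd; first exact: mUI.
  by rewrite (lt_le_trans muUI)// lee_fin ge_min lexx orbT.
have Fl := acFd l lab lpw.
have {}Fl : \sum_(p <- l) `|F p.2 - F p.1| < eps.
  by apply: Fl; rewrite (le_lt_trans lm)// (lt_le_trans mab)// ge_min lexx.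
have -> : e = eps * (b - a + 2) by rewrite /eps divfK// gt_eqF.
move: lG Fl Jab; lra.
Qed.

Lemma abs_cont_on_within {R : realType} (a b : R) (f : R -> R) :
  abs_cont_on a b f -> {within `[a, b], continuous f}.
Proof.
move=> acf; apply/subspace_continuousP => x /= xab.
apply/cvgrPdist_lt => e e0; have [d d0 dP] := acf _ e0.
have [ax xb] : a <= x /\ x <= b by move: xab; rewrite in_itv/= => /andP.
exists d => //= t xtd; rewrite in_itv/= => /andP[at_ tb].
have single u v : a <= u -> u <= v -> v <= b -> v - u < d -> `|f v - f u| < e.
  move=> au uv vb uvd; have := dP 1%N (fun=> u) (fun=> v).
  by rewrite !big_ord1; apply => // -[|i] [|j].
have [tx|/ltW xt] := leP t x.
  by apply: single => //; rewrite (le_lt_trans _ xtd)// ler_norm.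
rewrite distrC; apply: single => //.
by rewrite (le_lt_trans _ xtd)// distrC ler_norm.
Qed.

Lemma abs_cont_on_bounded {R : realType} (a b : R) (f : R -> R) :
  abs_cont_on a b f ->
  exists2 M : R, 0 < M & forall x, a <= x <= b -> `|f x| <= M.
Proof.
move=> /abs_cont_on_within cf.
have [M [_ MP]] :=
  compact_bounded (continuous_compact cf (@segment_compact _ a b)).
exists (`|M| + 1); first by rewrite ltr_wpDl.
move=> x xab; apply: (MP (`|M| + 1)); first by rewrite ltr_pwDr// ler_norm.
by exists x => //=; rewrite in_itv/=.
Qed.

Lemma abs_cont_onS {R : realType} (a b c d : R) (f : R -> R) :
  a <= c -> d <= b -> abs_cont_on a b f -> abs_cont_on c d f.
Proof.
move=> ac db acf e e0; have [r r0 rP] := acf _ e0; exists r => // n u v uv.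
apply: rP => i /uv[cu [uiv vd]]; split; first exact: le_trans cu.
by split => //; exact: le_trans db.
Qed.

Lemma lipschitz_abs_cont_on {R : realType} (a b L : R) (f : R -> R) :
  (forall x y, `|f x - f y| <= L * `|x - y|) -> abs_cont_on a b f.
Proof.
move=> fL e e0; pose K := `|L| + 1.
have K0 : 0 < K by rewrite ltr_wpDl.
exists (e / K); first by rewrite divr_gt0.
move=> n u v uv _ uvd.
apply: (@le_lt_trans _ _ (K * \sum_(i < n) (v i - u i))); last first.
  by rewrite mulrC -ltr_pdivlMr.
rewrite mulr_sumr ler_sum// => i _; apply: (le_trans (fL _ _)).
have [_ [uiv _]] := uv i (ltn_ord i).
rewrite [`|v i - u i|]ger0_norm ?subr_ge0// ler_wpM2r ?subr_ge0//.
by rewrite /K ler_wpDr// ler_norm.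
Qed.

Lemma abs_cont_onM {R : realType} (a b : R) (f g : R -> R) :
  abs_cont_on a b f -> abs_cont_on a b g ->
  abs_cont_on a b (fun x => f x * g x).
Proof.
move=> acf acg e e0.
have [M M0 fM] := abs_cont_on_bounded _ _ _ acf.
have [N N0 gN] := abs_cont_on_bounded _ _ _ acg.
have [d1 d10 fd] := acf (e / (2 * N)) (divr_gt0 e0 (mulr_gt0 (ltr0n _ 2) N0)).
have [d2 d20 gd] := acg (e / (2 * M)) (divr_gt0 e0 (mulr_gt0 (ltr0n _ 2) M0)).
exists (Num.min d1 d2); first by rewrite lt_min d10.
move=> n u v uv disj; rewrite lt_min => /andP[uvd1 uvd2].
have {}fd := fd n u v uv disj uvd1.
have {}gd := gd n u v uv disj uvd2.
apply: (@le_lt_trans _ _ (N * (\sum_(i < n) `|f (v i) - f (u i)|) +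
                          M * (\sum_(i < n) `|g (v i) - g (u i)|))).
  rewrite !mulr_sumr -big_split ler_sum// => i _ /=.
  have [au [uiv vb]] := uv i (ltn_ord i).
  have -> : f (v i) * g (v i) - f (u i) * g (u i) =
      g (v i) * (f (v i) - f (u i)) + f (u i) * (g (v i) - g (u i)) by ring.
  rewrite (le_trans (ler_normD _ _))// !normrM lerD// ler_wpM2r//.
    by apply: gN; rewrite vb andbT (le_trans au).
  by apply: fM; rewrite au (le_trans uiv).
have -> : e = N * (e / (2 * N)) + M * (e / (2 * M)).
  by field; rewrite !gt_eqF.
by apply: ltrD; rewrite ltr_pM2l.
Qed.

Lemma bounded_derive_lipschitz {R : realType} (f df : R -> R) (L : R) :
  (forall x : R, is_derive x 1 f (df x)) -> (forall x, `|df x| <= L) ->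
  forall x y, `|f x - f y| <= L * `|x - y|.
Proof.
move=> fdf dfL x y; wlog xy : x y / x <= y.
  by move=> wl; have [/wl//|/ltW/wl] := leP x y; rewrite distrC (distrC y).
have cf : {within `[x, y], continuous f}.
  apply: continuous_subspaceT => z.
  by apply/differentiable_continuous/derivable1_diffP; case: (fdf z).
have [c _ fE] := MVT_segment xy (fun z _ => fdf z) cf.
by rewrite distrC fE normrM (distrC x) ler_wpM2r.
Qed.

Lemma is_derive_sinB {R : realType} (x y : R) :
  is_derive x 1 (fun z => sin (z - y)) (cos (x - y)).
Proof.
have -> : (fun z => sin (z - y)) = cos y \*: @sin R - sin y \*: @cos R.
  apply/funext => z; rewrite sinB.
  change (sin z * cos y - cos z * sin y = cos y * sin z - sin y * cos z).
  by ring.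
apply: is_derive_eq; rewrite cosB /GRing.scale/=; ring.
Qed.

Lemma is_derive_cosB {R : realType} (x y : R) :
  is_derive x 1 (fun z => cos (z - y)) (- sin (x - y)).
Proof.
have -> : (fun z => cos (z - y)) = cos y \*: @cos R + sin y \*: @sin R.
  apply/funext => z; rewrite cosB.
  change (cos z * cos y + sin z * sin y = cos y * cos z + sin y * sin z).
  by ring.
apply: is_derive_eq; rewrite sinB /GRing.scale/=; ring.
Qed.

Lemma is_derive_K_i_lt {R : realType} (x y : R) : x < y ->
  is_derive x 1 (fun z => K_i z y) (pi / 2 * cos (x - y)).
Proof.
move=> xy.
apply: (@near_eq_is_derive _ _ _ (cst 2 + (pi / 2) \*: (fun z => sin (z - y)))).
  near=> z; rewrite /K_i distrC ger0_norm; last first.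
    by rewrite subr_ge0; apply/ltW; near: z; exact: lt_nbhsl.
  by rewrite -[y - z]opprB sinN mulrN opprK.
have dsin := is_derive_sinB x y.
by apply: is_derive_eq; rewrite add0r.
Unshelve. all: by end_near. Qed.

Lemma is_derive_K_i_gt {R : realType} (x y : R) : y < x ->
  is_derive x 1 (fun z => K_i z y) (- (pi / 2 * cos (x - y))).
Proof.
move=> yx.
apply: (@near_eq_is_derive _ _ _ (cst 2 - (pi / 2) \*: (fun z => sin (z - y)))).
  near=> z; rewrite /K_i ger0_norm//.
  by rewrite subr_ge0; apply/ltW; near: z; exact: lt_nbhsr.
have dsin := is_derive_sinB x y.
by apply: is_derive_eq; rewrite sub0r.
Unshelve. all: by end_near. Qed.

Lemma abs_cont_on_K_i {R : realType} (a b y : R) :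
  abs_cont_on a b (fun x => K_i x y).
Proof.
have pi20 : 0 <= pi / 2 :> R by rewrite divr_ge0// pi_ge0.
apply: (@lipschitz_abs_cont_on _ _ _ (pi / 2)) => s t.
have sinL := bounded_derive_lipschitz _ _ _ (@is_derive_sin R) (@cos_max R).
have -> : K_i s y - K_i t y = - (pi / 2 * (sin `|s - y| - sin `|t - y|)).
  by rewrite /K_i; ring.
rewrite normrN normrM (ger0_norm pi20) ler_wpM2l//.
apply: (le_trans (sinL _ _)); rewrite mul1r (le_trans (ler_dist_dist _ _))//.
by rewrite (_ : _ - _ - _ = s - t)//; ring.
Qed.

Lemma abs_cont_on_cosB {R : realType} (a b c y : R) :
  abs_cont_on a b (fun x => c * cos (x - y)).
Proof.
apply: (@lipschitz_abs_cont_on _ _ _ `|c|) => s t.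
rewrite -mulrBr normrM ler_wpM2l//.
have := bounded_derive_lipschitz (fun z => cos (z - y)) _ 1
  (fun x => is_derive_cosB x y).
by rewrite -[leRHS]mul1r; apply => x; rewrite normrN sin_max.
Qed.

Lemma K_i_in_H1_0 {R : realType} (y : R) : Delta R y -> H1_0 (fun x => K_i x y).
Proof.
rewrite /Delta /= in_itv/= => /andP[ay yb].
split; last first.
  rewrite /K_i ler0_norm ?subr_le0// ger0_norm ?subr_ge0//.
  have -> : - (- (pi / 2) - y) = y + pi / 2 by ring.
  have -> : pi / 2 - y = - (y - pi / 2) by ring.
  by rewrite sinN sinDpihalf sinBpihalf opprK.
split; first exact: abs_cont_on_K_i.
pose c x : R := pi / 2 * cos (x - y).
have cc : continuous c.
  move=> x; apply/differentiable_continuous/derivable1_diffP.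
  have dcos := is_derive_cosB x y.
  exact: (@derivableZ _ _ _ (fun z => cos (z - y))).
have mc : measurable_fun setT c by exact: continuous_measurable_fun.
exists (fun x => if x < y then c x else - c x).
  exists [set y]; split; [exact: measurable_set1|exact: lebesgue_measure_set1|].
  move=> x /=; apply: contra_notP => /eqP; rewrite neq_lt => /orP[xy|yx] _.
    by rewrite xy; exact: is_derive_K_i_lt.
  by rewrite (lt_gtF yx); exact: is_derive_K_i_gt.
split.
  apply: measurable_funTS; apply: measurable_fun_ifT => //.
    exact: measurable_fun_ltr.
  exact: measurableT_comp.
have -> : (fun x => ((if x < y then c x else - c x) ^+ 2)%:E) =
    EFin \o (fun x => c x * c x).
  by apply/funext => x /=; case: ifP; rewrite ?sqrrN expr2.
apply: continuous_compact_integrable; first exact: segment_compact.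
by apply: continuous_subspaceT => x; apply: cvgM; exact: cc.
Qed.

Lemma sq_integrableM {R : realType} (D : set R) (f g : R -> R) :
  measurable D -> sq_integrable D f -> sq_integrable D g ->
  mu.-integrable D (EFin \o (fun x => f x * g x)).
Proof.
move=> mD [mf if2] [mg ig2].
apply: (@le_integrable _ _ _ mu D _ _
  (fun x => (f x ^+ 2)%:E + (g x ^+ 2)%:E)%E) => //.
- by apply/measurable_EFinP; exact: measurable_funM.
- move=> x _; rewrite /= lee_fin normrM [leRHS]ger0_norm ?addr_ge0 ?sqr_ge0//.
  rewrite -(real_normK (num_real (f x))) -(real_normK (num_real (g x))).
  have := sqr_ge0 (`|f x| - `|g x|); have := sqr_ge0 (`|f x| + `|g x|).
  by rewrite sqrrD sqrrB; lra.
- exact: integrableD.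
Qed.

Lemma intD_K_i {R : realType} (f f' k' : R -> R) (y : R) :
  H1_with_deriv f f' -> f (- (pi / 2)) = f (pi / 2) -> Delta R y ->
  H1_with_deriv (fun x => K_i x y) k' ->
  intD (fun x => f x * K_i x y - f' x * k' x) = 2 * intD f - pi * f y.
Proof.
move=> [acf [df sf']] fpi + [_ [dk sk']].
rewrite {1}/Delta /= in_itv/= => /andP[ay yb].
pose c x : R := pi / 2 * cos (x - y).
have dc (x : R) : is_derive x 1 c (- (pi / 2 * sin (x - y))).
  have dcos := is_derive_cosB x y.
  have := is_deriveZ (pi / 2) dcos.
  by rewrite /GRing.scale/= mulrN.
pose phi x := f x * K_i x y - f' x * k' x.
pose psi x := 2 * f x - phi x.
have mD : measurable (Delta R) by exact: measurable_itv.
have jf : mu.-integrable (Delta R) (EFin \o f).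
  apply: continuous_compact_integrable; first exact: segment_compact.
  exact: abs_cont_on_within.
have j2f : mu.-integrable (Delta R) (EFin \o (fun x => 2 * f x)).
  by have j := @integrableZl _ _ _ mu _ mD 2 _ jf; refine j.
have jfK : mu.-integrable (Delta R) (EFin \o (fun x => f x * K_i x y)).
  apply: continuous_compact_integrable; first exact: segment_compact.
  apply: abs_cont_on_within; apply: abs_cont_onM => //.
  exact: abs_cont_on_K_i.
have jphi : mu.-integrable (Delta R) (EFin \o phi).
  have jf'k' := sq_integrableM _ _ _ mD sf' sk'.
  by have j := @integrableB _ _ _ mu _ mD _ _ jfK jf'k'; refine j.
have jpsi : mu.-integrable (Delta R) (EFin \o psi).
  by have j := @integrableB _ _ _ mu _ mD _ _ j2f jphi; refine j.
have acfc : abs_cont_on (- (pi / 2)) (pi / 2) (fun x => f x * c x).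
  by apply: abs_cont_onM => //; exact: abs_cont_on_cosB.
have left_half : \int[mu]_(x in `[- (pi / 2), y]) psi x =
    f y * c y - f (- (pi / 2)) * c (- (pi / 2)).
  apply: (@abs_cont_FTC2 _ _ _ (fun x => f x * c x)) => //.
  - exact: abs_cont_onS acfc.
  - move: df dk; apply: filterS2; first exact: (ae_filter_ringOfSetsType mu).
    move=> x dfx dkx /andP[ax xy].
    have Dx : Delta R x by rewrite /Delta /= in_itv/= !ltW// (lt_le_trans xy).
    have [_ kE] := dkx Dx; have [_] := is_derive_K_i_lt _ _ xy.
    rewrite kE /psi /phi => ->; have dfx' := dfx Dx.
    have := is_deriveM dfx' (dc x); move/is_derive_eq; apply.
    rewrite /K_i distrC gtr0_norm ?subr_gt0// -[y - x]opprB sinN.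
    by rewrite /GRing.scale/= /c; ring.
  - by apply: integrableS jpsi => //; apply: subset_itvl; exact: yb.
have right_half : \int[mu]_(x in `[y, pi / 2]) psi x =
    f (pi / 2) * - c (pi / 2) - f y * - c y.
  apply: (@abs_cont_FTC2 _ _ _ (fun x => f x * - c x)) => //.
  - apply: abs_cont_onM; first exact: abs_cont_onS acf.
    rewrite /c; under eq_fun do rewrite -mulNr.
    exact: abs_cont_on_cosB.
  - move: df dk; apply: filterS2; first exact: (ae_filter_ringOfSetsType mu).
    move=> x dfx dkx /andP[yx xb].
    have Dx : Delta R x by rewrite /Delta /= in_itv/= !ltW// (le_lt_trans ay).
    have [_ kE] := dkx Dx; have [_] := is_derive_K_i_gt _ _ yx.
    rewrite kE /psi /phi => ->; have dfx' := dfx Dx.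
    have := is_deriveM dfx' (is_deriveN (dc x)); move/is_derive_eq; apply.
    rewrite /K_i gtr0_norm ?subr_gt0// /GRing.scale/=.
    by change ((- c) x) with (- c x); rewrite /c; ring.
  - by apply: integrableS jpsi => //; apply: subset_itvr; exact: ay.
have intpsi : intD psi = pi * f y.
  have := @Rintegral_itvB R psi (BLeft (- (pi / 2))) (BRight (pi / 2)) y jpsi.
  rewrite !bnd_simp => /(_ ay yb).
  rewrite Rintegral_itv_obnd_cbnd; last first.
    by apply: integrableS jpsi => //; apply: subset_itvr; exact: ay.
  rewrite left_half right_half -/(intD psi) => /eqP; rewrite subr_eq => /eqP ->.
  rewrite fpi /c subrr cos0.
  have -> : - (pi / 2) - y = - (y + pi / 2) by ring.
  have -> : pi / 2 - y = - (y - pi / 2) by ring.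
  by rewrite !cosN cosDpihalf cosBpihalf; field.
move: intpsi; rewrite /intD RintegralB// RintegralZl// => intpsi.
by rewrite -intpsi; ring.
Qed.

Lemma H1_with_deriv_cst {R : realType} (r : R) :
  H1_with_deriv (fun=> r) (fun=> 0).
Proof.
split.
  apply: (@lipschitz_abs_cont_on _ _ _ 0) => x z.
  by rewrite subrr normr0 mul0r.
split; first by apply: aeW => x _; exact: is_derive_cst.
split; first exact: measurable_cst.
under eq_fun do rewrite expr0n.
exact: integrable0.
Qed.

Lemma intD_cst {R : realType} (r : R) : intD (fun=> r) = r * pi.
Proof.
rewrite /intD /Delta Rintegral_cst//= lebesgue_measure_itv/= lte_fin.
have pi20 : 0 < pi / 2 :> R by rewrite divr_gt0// pi_gt0.
rewrite (lt_trans _ pi20) ?oppr_lt0//=.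
by congr (_ * _); field.
Qed.

Theorem theorem3p3 (R : realType) (f f' : R -> R) (y : R) :
  H1_with_deriv f f' -> f (- (pi / 2)) = f (pi / 2) ->
  Delta R y ->
  H1_0 (fun x => K_i x y) /\
  (forall k' : R -> R, H1_with_deriv (fun x => K_i x y) k' ->
     f y = inner_i f f' (fun x => K_i x y) k').
Proof.
move=> hf fpi yD; split; first exact: K_i_in_H1_0.
move=> k' hk; have := intD_K_i _ _ _ _ (H1_with_deriv_cst 1) erefl yD hk.
under eq_fun do rewrite mul1r mul0r subr0.
rewrite intD_cst => intK.
rewrite /inner_i (intD_K_i _ _ _ _ hf fpi yD hk) intK.
have : (pi : R) != 0 by rewrite lt0r_neq0 ?pi_gt0.
by move: (intD f) pi => i p p0; field.
Qed.
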